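(* There exist absolute constants $\beta\in(0,1)$ and $c>0$ such that the following holds. Let $\eta>0$, $M=\max(m_1,m_2)$, and let $r$ be an integer with $1\le r\le\min(m_1,m_2)$ and $Mr\le n$. Let $(X_i,Y_i)$, $i=1,\dots,n$, be i.i.d. realizations of a random pair $(X,Y)$ with distribution $P_{XY}$. Then $$\inf_{\hat A}\ \sup_{\mathrm{rank}(A)\le r}\ \sup_{P_{XY}\in\mathcal P_\eta}\mathbb P\left(R(\hat A)\ge R(A)+c\,\eta^2\,\frac{Mr}{n}\right)\ge\beta .$$
   Context: $\mathcal X=\{e_j(m_1)e_k(m_2)^\top:1\le j\le m_1,\,1\le k\le m_2\}$, where $e_k(d)$ are the canonical basis vectors of $\mathbb R^d$; $\Pi_0$ is the uniform distribution on $\mathcal X$; $\mathcal P_\eta=\{P_{XY}:X\sim\Pi_0,\ |Y|\le\eta\ \text{(a.s.)}\}$. The prediction risk is $R(A)=\mathbb E[(Y-\langle A,X\rangle)^2]$ for $A\in\mathbb R^{m_1\times m_2}$ (expectation under $P_{XY}$), with $\langle A,B\rangle=\mathrm{tr}(A^\top B)$; $R(\hat A)$ is the function $R$ evaluated at the random matrix $\hat A$. $\inf_{\hat A}$ is the infimum over all estimators, i.e. measurable functions of $(X_1,Y_1,\dots,X_n,Y_n)$ with values in $\mathbb R^{m_1\times m_2}$; the supremum over $A$ is over matrices in $\mathbb R^{m_1\times m_2}$ of rank at most $r$; $\mathbb P$ is the law of the sample. *)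

(* Defs.v *)
From HB Require Import structures.
From mathcomp Require Import all_boot all_order all_algebra.
From mathcomp Require Import all_classical all_reals all_analysis.

Set Implicit Arguments.
Unset Strict Implicit.
Unset Printing Implicit Defensive.

Import Order.TTheory GRing.Theory Num.Theory.
Import numFieldNormedType.Exports.

Local Open Scope classical_set_scope.
Local Open Scope ring_scope.

(* Real matrices carry the Borel sigma-algebra of their usual topology. *)
Section borel_matrix.
Context (R : realType) (m n : nat).

Let borel : set (set 'M[R]_(m, n)) := <<s @open 'M[R]_(m, n) >>.

Let borel0 : borel set0.
Proof. exact: sigma_algebra0. Qed.

Let borelC A : borel A -> borel (~` A).
Proof. exact: sigma_algebraC. Qed.

Let borel_bigcup (F : (set 'M[R]_(m, n))^nat) :
  (forall i, borel (F i)) -> borel (\bigcup_i F i).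
Proof. exact: sigma_algebra_bigcup. Qed.

HB.instance Definition _ := @isMeasurable.Build
  (sigma_display (@open 'M[R]_(m, n))) 'M[R]_(m, n)
  borel borel0 borelC borel_bigcup.

End borel_matrix.

Section iid.
Context {R : realType} {d : measure_display} {T : measurableType d}.

Definition cons_pair (n : nat) (z : T * n.-tuple T) : n.+1.-tuple T :=
  [tuple of z.1 :: z.2].

Let measurable_cons_pair n : measurable_fun [set: T * n.-tuple T] (@cons_pair n).
Proof. exact: measurable_cons. Qed.

HB.instance Definition _ n :=
  isMeasurableFun.Build _ _ _ _ (@cons_pair n) (@measurable_cons_pair n).

(* The n-fold product of P, i.e. the law of n independent draws from P. *)
Fixpoint iid_law (P : probability T R) (n : nat) :
    probability (n.-tuple T) R :=
  match n with
  | 0 => dirac ([tuple] : 0.-tuple T)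
  | k.+1 => distribution (P \x iid_law P k)%E (@cons_pair k)
  end.

Lemma iid_law_rect (P : probability T R) (n : nat) (B : 'I_n -> set T) :
  (forall i, measurable (B i)) ->
  iid_law P n [set s | forall i, B i (tnth s i)] = (\prod_(i < n) P (B i))%E.
Proof.
elim: n B => [|n IHn] B mB.
  by rewrite big_ord0 /= diracE mem_set// => -[].
have mC : measurable [set s : n.-tuple T | forall i, B (lift ord0 i) (tnth s i)].
  rewrite (_ : mkset _ = \bigcap_(i in [set: 'I_n])
      ((fun s : n.-tuple T => tnth s i) @^-1` B (lift ord0 i))); last first.
    by apply/seteqP; split=> [s Bs i _|s Bs i]; exact: Bs.
  apply: fin_bigcap_measurable => // i _; rewrite -[X in measurable X]setTI.
  exact: measurable_tnth.
rewrite big_ord_recl -(IHn (fun i => B (lift ord0 i)))// -product_measure1E//.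
congr ((P \x iid_law P n)%E _).
apply/seteqP; split=> [[x s] /= Bs|[x s] /= [Bx Bs] i].
  split; first exact: Bs ord0.
  by move=> i; have := Bs (lift ord0 i); rewrite tnthS.
by have [j|] := unliftP ord0 i => [->|->]; rewrite ?tnthS.
Qed.

End iid.

Section trace_regression.
Context {R : realType} {m1 m2 : nat}.

Definition inner_prod (A B : 'M[R]_(m1, m2)) : R := \tr (A^T *m B).

Definition basis_vec (d : nat) (k : 'I_d) : 'cV[R]_d := delta_mx k 0.

(* The uniform distribution on {e_j(m1) e_k(m2)^T}: the m1 * m2 matrices
   indexed by (j, k) are pairwise distinct, so each one gets mass 1/(m1 m2). *)
Definition uniform_basis (B : set 'M[R]_(m1, m2)) : \bar R :=
  (((m1 * m2)%:R^-1)%:E *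
   \sum_(j < m1) \sum_(k < m2) \d_(basis_vec j *m (basis_vec k)^T) B)%E.

Definition bounded_laws (eta : R) :
    set (probability ('M[R]_(m1, m2) * R)%type R) :=
  [set P : probability ('M[R]_(m1, m2) * R)%type R |
    (forall B, measurable B -> P (fst @^-1` B) = uniform_basis B) /\
    {ae P, forall z : 'M[R]_(m1, m2) * R, `|z.2| <= eta}].

Definition risk (P : probability ('M[R]_(m1, m2) * R)%type R)
    (A : 'M[R]_(m1, m2)) : \bar R :=
  'E_P[fun z : 'M[R]_(m1, m2) * R => (z.2 - inner_prod A z.1) ^+ 2].

End trace_regression.

(* Main.v *)
(** Assouad's method with binary labels.  Hide an independent fair sign [s c] in
each cell [c] of a grid of size [M * r], and let entry [(j, k)] read the cell
obtained by reducing the index along the shorter dimension modulo [r].  The matrix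
[A_s] with entries [eps * eta * s(cell (j, k))] has rank at most [r].  If [Y] is
[eta] or [- eta] with conditional mean [A_s(X)], then
[R(B) - R(A_s)] is the mean squared distance of the entries of [B] and [A_s], which
is at least [eps^2 * eta^2] times the fraction of entries of [B] of the wrong sign.
A cell has mass at most [2 / (M r)], so for [eps^2 = M r / (8 n)] two
sign patterns differing in one cell cannot be told apart from [n] observations, and
each sign is guessed wrongly with probability at least 1/8 on average. *)

From HB Require Import structures.
Require Import Defs.
From mathcomp Require Import all_boot all_order all_algebra.
From mathcomp Require Import all_classical all_reals all_analysis.
From mathcomp Require Import measurable_realfun ring lra zify.

Set Implicit Arguments.
Unset Strict Implicit.
Unset Printing Implicit Defensive.

Import Order.TTheory GRing.Theory Num.Theory.
Import numFieldNormedType.Exports.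

Local Open Scope classical_set_scope.
Local Open Scope ring_scope.

(** * Testing and Assouad's lemma *)

Lemma big_tuple_cons (R : Type) (idx : R) (op : Monoid.com_law idx)
    (I : finType) (n : nat) (F : n.+1.-tuple I -> R) :
  \big[op/idx]_(t : n.+1.-tuple I) F t =
  \big[op/idx]_(i : I) \big[op/idx]_(t : n.-tuple I) F [tuple of i :: t].
Proof.
rewrite pair_big (reindex (fun z : I * n.-tuple I => [tuple of z.1 :: z.2])) //=.
exists (fun t => (thead t, [tuple of behead t])) => [[i t] _|t _] /=.
  by congr pair; apply: val_inj.
by rewrite -tuple_eta.
Qed.

(** Distributivity, one coordinate at a time. It gives product laws total mass 1 and makes the
    affinity of [n] draws the [n]-th power of that of one draw. *)
Lemma sum_tuple_prod (R : comNzRingType) (I : finType) (n : nat) (w : I -> R) :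
  \sum_(t : n.-tuple I) \prod_(i <- t) w i = (\sum_i w i) ^+ n.
Proof.
elim: n => [|n IHn].
  rewrite expr0 (big_pred1 [tuple]) ?big_nil// => t.
  by rewrite /= [t]tuple0; apply/esym/eqP/val_inj.
rewrite big_tuple_cons exprS -IHn mulr_suml; apply: eq_bigr => i _.
by rewrite mulr_sumr; apply: eq_bigr => t _; rewrite big_cons.
Qed.

Lemma prodr_sqrt (R : rcfType) (I : Type) (s : seq I) (a : I -> R) :
  (forall i, 0 <= a i) ->
  \prod_(i <- s) Num.sqrt (a i) = Num.sqrt (\prod_(i <- s) a i).
Proof.
move=> a0; elim: s => [|i s IHs]; first by rewrite !big_nil sqrtr1.
by rewrite !big_cons sqrtrM// IHs.
Qed.

(* Summed over the sample space, this bounds the testing error [\sum_t min(P t, Q t)]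
   below by the Hellinger affinity, which is multiplicative in the sample size. *)
Lemma sqrtrM_subr_le_min (R : rcfType) (a b : R) : 0 <= a -> 0 <= b ->
  Num.sqrt (a * b) - (a + b) / 4 <= Num.min a b.
Proof.
move=> a0 b0; rewrite sqrtrM//.
have := sqr_sqrtr a0; have := sqr_sqrtr b0.
move: (Num.sqrt a) (Num.sqrt b) (sqrtr_ge0 a) (sqrtr_ge0 b) => x y x0 y0 <- <-.
rewrite le_min; apply/andP; split.
  by have := sqr_ge0 (x - y / 2); nra.
by have := sqr_ge0 (y - x / 2); nra.
Qed.

Lemma bernoulli_ineq (R : realDomainType) (x : R) (n : nat) :
  0 <= x <= 1 -> 1 - n%:R * x <= (1 - x) ^+ n.
Proof.
move=> /andP[x0 x1]; elim: n => [|n IHn]; first by rewrite mul0r subr0.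
rewrite exprS -natr1 mulrDl mul1r; have : 0 <= n%:R * x by rewrite mulr_ge0.
move: (n%:R * x) IHn => y IHn y0.
have : (1 - x) * (1 - y) <= (1 - x) * (1 - x) ^+ n.
  by rewrite ler_wpM2l// subr_ge0.
have := mulr_ge0 x0 y0.
nra.
Qed.

(** The errors are [test t] under [p] and [~~ test t] under [q]. The affinity of the product laws is
    at least [(1 - h) ^+ n >= 3 / 4], and the two total masses cost [2 / 4]. *)
Lemma two_point_testing (R : rcfType) (I : finType) (n : nat) (p q : I -> R)
    (h : R) (test : n.-tuple I -> bool) :
  (forall i, 0 <= p i) -> (forall i, 0 <= q i) ->
  \sum_i p i = 1 -> \sum_i q i = 1 ->
  0 <= h <= 1 -> n%:R * h <= 1 / 4 ->
  1 - h <= \sum_i Num.sqrt (p i * q i) ->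
  1 / 4 <= \sum_(t : n.-tuple I) (\prod_(i <- t) p i) *+ test t +
           \sum_(t : n.-tuple I) (\prod_(i <- t) q i) *+ ~~ test t.
Proof.
move=> p0 q0 p1 q1 h01 nh aff.
have pt0 (t : n.-tuple I) : 0 <= \prod_(i <- t) p i by apply: prodr_ge0.
have qt0 (t : n.-tuple I) : 0 <= \prod_(i <- t) q i by apply: prodr_ge0.
have step : \sum_(t : n.-tuple I)
      (Num.sqrt ((\prod_(i <- t) p i) * (\prod_(i <- t) q i)) -
       (\prod_(i <- t) p i + \prod_(i <- t) q i) / 4) <=
    \sum_(t : n.-tuple I) ((\prod_(i <- t) p i) *+ test t +
      (\prod_(i <- t) q i) *+ ~~ test t).
  apply: ler_sum => t _; apply: le_trans (sqrtrM_subr_le_min _ _) _ => //.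
  by case: (test t); rewrite /= ?mulr1n ?mulr0n ?addr0 ?add0r ge_min lexx ?orbT.
rewrite -big_split; apply: le_trans step.
rewrite sumrB -mulr_suml big_split /= !sum_tuple_prod p1 q1 !expr1n.
under eq_bigr => t _.
  rewrite -big_split -prodr_sqrt => [|i]; last by rewrite mulr_ge0.
  over.
rewrite sum_tuple_prod.
have : 1 - n%:R * h <= (\sum_i Num.sqrt (p i * q i)) ^+ n.
  apply: le_trans (bernoulli_ineq n h01) _.
  apply: lerXn2r aff; rewrite nnegrE; last first.
    by apply: sumr_ge0 => i _; exact: sqrtr_ge0.
  by rewrite subr_ge0; case/andP: h01.
lra.
Qed.

Definition flip (K : finType) (k : K) (s : {ffun K -> bool}) : {ffun K -> bool} :=
  [ffun l => s l (+) (l == k)].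

Lemma flipK (K : finType) (k : K) : involutive (flip k).
Proof. by move=> s; apply/ffunP => l; rewrite !ffunE addbK. Qed.

(* Under the uniform prior on [s] each guess errs with probability at least 1/8;
   the error fraction lies in [0, 1], so this bound on its mean yields one on its
   upper tail. *)
Lemma assouad (R : rcfType) (I X K : finType) (n : nat) (cell : X -> K)
    (p : {ffun K -> bool} -> I -> R) (h : R)
    (guess : X -> n.-tuple I -> bool) :
  (0 < #|X|)%N ->
  (forall s i, 0 <= p s i) -> (forall s, \sum_i p s i = 1) ->
  0 <= h <= 1 -> n%:R * h <= 1 / 4 ->
  (forall k s, 1 - h <= \sum_i Num.sqrt (p s i * p (flip k s) i)) ->
  exists s, 1 / 16 <= \sum_(t : n.-tuple I) (\prod_(i <- t) p s i) *+
    (#|X|%:R / 16 <= \sum_x (guess x t != s (cell x))%:R :> R)%R.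
Proof.
move=> X0 p0 p1 h01 nh aff.
pose N : R := #|X|%:R; have N0 : 0 < N by rewrite ltr0n.
pose P s t : R := \prod_(i <- (t : n.-tuple I)) p s i.
have P0 s t : 0 <= P s t by apply: prodr_ge0.
have P1 s : \sum_t P s t = 1 by rewrite sum_tuple_prod p1 expr1n.
pose S : R := #|{ffun K -> bool}|%:R.
have S0 : 0 < S by rewrite ltr0n; apply/card_gt0P; exists [ffun=> false].
have sumS (a : R) : \sum_(s : {ffun K -> bool}) a = S * a.
  by rewrite sumr_const /S mulr_natl.
have errx x : S / 8 <= \sum_s \sum_t P s t *+ (guess x t != s (cell x)).
  set e := \sum_s _.
  (* Flipping the cell of [x] permutes the patterns, so [e + e] pairs each [s] with its flip; each
     pair yields both errors of one test. *)
  have e2 : e + e = \sum_s (\sum_t P s t *+ (guess x t != s (cell x)) +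
      \sum_t P (flip (cell x) s) t *+ ~~ (guess x t != s (cell x))).
    rewrite big_split /=; congr (_ + _).
    rewrite /e (reindex_inj (inv_inj (flipK (cell x)))) /=.
    apply: eq_bigr => s _; apply: eq_bigr => t _; congr (_ *+ _).
    by rewrite ffunE eqxx addbT; case: (guess x t) (s _) => [] [].
  have : \sum_(s : {ffun K -> bool}) (1 / 4 : R) <= e + e.
    rewrite e2; apply: ler_sum => s _.
    exact: (@two_point_testing _ _ _ _ _ h).
  rewrite sumS; lra.
pose D (s : {ffun K -> bool}) t : R := \sum_x (guess x t != s (cell x))%:R.
(* Reverse Markov: [D] is at most [N] on the tail event and at most [N / 16] off it. *)
have DN s t : D s t <= N *+ (N / 16 <= D s t)%R + N / 16.
  case: (leP (N / 16) (D s t)) => [_|/ltW]; rewrite /= ?mulr1n ?mulr0n ?add0r//.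
  apply: (@le_trans _ _ N); last by lra.
  rewrite /N -sum1_card natr_sum; apply: ler_sum => x _.
  by case: (_ != _); rewrite ?ler01.
pose pi s : R := \sum_t P s t *+ (N / 16 <= D s t)%R.
suff /existsP[s] : [exists s, 1 / 16 <= pi s] by exists s.
(* If every [pi s] were below [1 / 16], the mean of [D] would be below [N / 16 + N / 16], against
   the lower bound [N / 8] given by [errx]. *)
apply: contraT; rewrite negb_exists => /forallP small.
have s0 : {ffun K -> bool} := [ffun=> false].
have : \sum_s pi s < \sum_(s : {ffun K -> bool}) (1 / 16 : R).
  apply: ltr_sum => [|s _]; last by rewrite ltNge small.
  by apply/hasP; exists s0; rewrite ?mem_index_enum.
rewrite sumS => lt16.
have : N * (S / 8) <= \sum_s \sum_t P s t * D s t.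
  have -> : N * (S / 8) = \sum_(x : X) S / 8.
    by rewrite sumr_const /N mulr_natl.
  apply: le_trans (ler_sum _ (fun x _ => errx x)) _.
  rewrite exchange_big /=; apply: ler_sum => s _.
  rewrite exchange_big /=; apply: ler_sum => t _.
  by rewrite mulr_sumr; apply: ler_sum => x _; rewrite mulr_natr.
have : \sum_s \sum_t P s t * D s t <= \sum_s (N * pi s + N / 16).
  apply: ler_sum => s _.
  have -> : N * pi s + N / 16 =
      \sum_t P s t * (N *+ (N / 16 <= D s t)%R + N / 16).
    under eq_bigr do rewrite mulrDr mulrnAr [_ * N]mulrC -mulrnAr.
    by rewrite big_split /= -mulr_sumr -mulr_suml P1 mul1r.
  by apply: ler_sum => t _; exact: ler_wpM2l.
rewrite big_split /= -mulr_sumr sumS.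
nra.
Qed.

(** * Finitely supported laws *)

Section discrete_law.
Context {R : realType} {d : measure_display} {T : measurableType d}.
Context {I : finType} (w : I -> {nonneg R}) (pt : I -> T).

(* [msum] ranges over natural numbers, hence the detour through an enumeration
   of [I]. *)
Definition atom (k : nat) : {measure set T -> \bar R} :=
  if insub k : option 'I_#|I| is Some j
  then mscale (w (enum_val j)) \d_(pt (enum_val j)) else mzero.

Definition discrete_law : set T -> \bar R := msum atom #|I|.

HB.instance Definition _ := Measure.on discrete_law.

Lemma atomE (j : 'I_#|I|) :
  atom j = mscale (w (enum_val j)) \d_(pt (enum_val j)) :> {measure set T -> \bar R}.
Proof. by rewrite /atom valK. Qed.

Lemma discrete_lawE (B : set T) :
  discrete_law B = (\sum_i (w i)%:num%:E * \d_(pt i) B)%E.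
Proof.
rewrite [RHS](reindex _ (onW_bij _ (@enum_val_bij I))) /=.
by rewrite /discrete_law/= /msum; apply: eq_bigr => j _; rewrite atomE.
Qed.

Lemma discrete_law_integral (f : T -> \bar R) :
  (forall x, (0 <= f x)%E) -> measurable_fun [set: T] f ->
  (\int[discrete_law]_x f x = \sum_i (w i)%:num%:E * f (pt i))%E.
Proof.
move=> f0 mf; rewrite ge0_integral_measure_sum//.
rewrite [RHS](reindex _ (onW_bij _ (@enum_val_bij I))) /=.
apply: eq_bigr => j _; rewrite atomE ge0_integral_mscale//.
by rewrite integral_dirac// diracT mul1e.
Qed.

Hypothesis w1 : \sum_i (w i)%:num = 1.

Lemma discrete_law_setT : discrete_law setT = 1%E.
Proof.
rewrite discrete_lawE -w1 -sumEFin; apply: eq_bigr => i _.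
by rewrite diracT mule1.
Qed.

End discrete_law.

Definition discrete_prob {R : realType} {d} {T : measurableType d} {I : finType}
  (w : I -> {nonneg R}) (pt : I -> T) (w1 : \sum_i (w i)%:num = 1) :
  probability T R := HB.pack (discrete_law w pt)
    (@Measure_isProbability.Build _ _ _ (discrete_law w pt) (discrete_law_setT pt w1)).

(** Reduces events about samples to sums over index tuples, the form in which [assouad] counts. *)
Lemma iid_law_discrete (R : realType) d (T : measurableType d) (I : finType)
    (w : I -> {nonneg R}) (pt : I -> T) (w1 : \sum_i (w i)%:num = 1) (n : nat)
    (B : set (n.-tuple T)) : measurable B ->
  iid_law (discrete_prob pt w1) n B =
    (\sum_(t : n.-tuple I) (\prod_(i <- t) (w i)%:num)%:E *
       \d_(map_tuple pt t) B)%E.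
Proof.
elim: n B => [|n IHn] B mB.
  rewrite (big_pred1 [tuple]) ?big_nil => [|t]; last first.
    by rewrite /= [t]tuple0; apply/esym/eqP/val_inj.
  by rewrite mul1e (_ : map_tuple pt _ = [tuple])//; exact: val_inj.
have mC : measurable (@cons_pair d T n @^-1` B).
  exact: (measurable_funPTI (@cons_pair d T n) mB).
(* The product measure integrates the sections of the event, to which the induction hypothesis
   applies. *)
rewrite /= /distribution /pushforward /product_measure1.
rewrite discrete_law_integral; [|by []|]; last first.
  exact: (measurable_fun_xsection (iid_law (discrete_prob pt w1) n) mC).
rewrite big_tuple_cons/=; apply: eq_bigr => i _.
rewrite IHn; last exact: measurable_xsection.
rewrite ge0_sume_distrr; last first.
  by move=> t _; rewrite mule_ge0// lee_fin prodr_ge0.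
apply: eq_bigr => t _; rewrite big_cons EFinM -muleA.
have <- : cons_pair (pt i, map_tuple pt t) = map_tuple pt [tuple of i :: t].
  exact: val_inj.
do 2 congr (_ * _)%E; rewrite !diracE; congr (nat_of_bool _)%:R%:E.
by rewrite mem_xsection.
Qed.

(** * The sign model *)

Lemma measurable_mx_entry (R : realType) (m n : nat) (i : 'I_m) (j : 'I_n) :
  measurable_fun [set: 'M[R]_(m, n)] (fun A : 'M[R]_(m, n) => A i j).
Proof.
apply: (measurability _ (RGenOpens.measurableE R)) => _ [_ [x [y ->] <-]].
rewrite setTI; apply: sub_sigma_algebra.
by have /continuousP := @coord_continuous R m n i j; apply; exact: interval_open.
Qed.

Lemma inner_prodE (R : realType) (m1 m2 : nat) (A B : 'M[R]_(m1, m2)) :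
  inner_prod A B = \sum_(x : 'I_m1 * 'I_m2) A x.1 x.2 * B x.1 x.2.
Proof.
rewrite -(pair_bigA _ (fun i j => A i j * B i j)) exchange_big /=.
by apply: eq_bigr => j _; rewrite !mxE; apply: eq_bigr => i _; rewrite mxE.
Qed.

Lemma measurable_inner_prod (R : realType) (m1 m2 : nat) (A : 'M[R]_(m1, m2)) :
  measurable_fun [set: 'M[R]_(m1, m2)] (inner_prod A).
Proof.
rewrite (_ : inner_prod A = fun B : 'M[R]_(m1, m2) =>
  \sum_(x : 'I_m1 * 'I_m2) A x.1 x.2 * B x.1 x.2).
  apply: measurable_sum => x; apply: measurable_funM => //.
  exact: measurable_mx_entry.
by apply/funext => B; exact: inner_prodE.
Qed.

Lemma basis_mxE (R : realType) (m1 m2 : nat) (i : 'I_m1) (j : 'I_m2) :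
  basis_vec i *m (basis_vec j)^T = delta_mx i j :> 'M[R]_(m1, m2).
Proof. by rewrite /basis_vec trmx_delta mul_delta_mx. Qed.

Lemma inner_prod_basis (R : realType) (m1 m2 : nat) (A : 'M[R]_(m1, m2)) i j :
  inner_prod A (basis_vec i *m (basis_vec j)^T) = A i j.
Proof.
rewrite inner_prodE basis_mxE (bigD1 (i, j))//= big1 ?addr0 => [|[k l] kl].
  by rewrite mxE !eqxx mulr1.
by rewrite mxE -xpair_eqE/= (negPf kl) mulr0.
Qed.

Lemma sum_prod_bool (V : nmodType) (X : finType) (F : X * bool -> V) :
  \sum_i F i = \sum_x (F (x, true) + F (x, false)).
Proof.
rewrite (eq_bigr (fun i => F (i.1, i.2))); last by case.
rewrite -(pair_bigA _ (fun x b => F (x, b))) /=.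
by apply: eq_bigr => x _; rewrite big_bool.
Qed.

Section sign_model.
Context {R : realType} {m1 m2 : nat} {K : finType}.
Hypothesis m_gt0 : (0 < m1 * m2)%N.
Context (cell : 'I_m1 * 'I_m2 -> K) (eps eta : R).
Hypothesis eps01 : 0 <= eps <= 1.
Implicit Type s : {ffun K -> bool}.
Local Notation N := ((m1 * m2)%:R : R).

(** The index [(x, b)] stands for entry [x] with label [eta * (-1) ^+ b]. Agreement with the hidden
    sign has conditional probability [(1 + eps) / 2], so the label has mean
    [eps * eta * (-1) ^+ s (cell x)]. *)
Definition sign_weight s (i : 'I_m1 * 'I_m2 * bool) : R :=
  N^-1 * ((1 + eps * (-1) ^+ (s (cell i.1) (+) i.2)) / 2).

Let N_gt0 : 0 < N. Proof. by rewrite ltr0n. Qed.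

Let cardX : #|{: 'I_m1 * 'I_m2}| = (m1 * m2)%N.
Proof. by rewrite card_prod !card_ord. Qed.

Let sum_cst (c : R) : \sum_(x : 'I_m1 * 'I_m2) c = N * c.
Proof. by rewrite sumr_const cardX mulr_natl. Qed.

Lemma sign_weight_ge0 s i : 0 <= sign_weight s i.
Proof.
move/andP: eps01 => [e0 e1]; rewrite mulr_ge0 ?invr_ge0 ?ler0n//.
by case: (_ (+) _); rewrite ?expr0 ?expr1; lra.
Qed.

Lemma sign_weight_sum1 s : \sum_i sign_weight s i = 1.
Proof.
rewrite sum_prod_bool (eq_bigr (fun=> N^-1)) => [|x _].
  by rewrite sum_cst mulfV// gt_eqF.
rewrite /sign_weight /= addbF addbT.
by case: (s _); rewrite /= ?expr0 ?expr1; lra.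
Qed.

Definition sign_point (i : 'I_m1 * 'I_m2 * bool) : ('M[R]_(m1, m2) * R)%type :=
  (basis_vec i.1.1 *m (basis_vec i.1.2)^T, eta * (-1) ^+ i.2).

Definition sign_law s : probability ('M[R]_(m1, m2) * R)%type R :=
  discrete_prob (w := fun i => NngNum (sign_weight_ge0 s i)) sign_point
    (sign_weight_sum1 s).

Definition sign_matrix s : 'M[R]_(m1, m2) :=
  \matrix_(j, k) (eps * eta * (-1) ^+ s (cell (j, k))).

Lemma sign_law_bounded s : 0 <= eta -> bounded_laws eta (sign_law s).
Proof.
move=> eta0; split=> [B mB|].
  rewrite /= discrete_lawE sum_prod_bool /uniform_basis pair_bigA /=.
  rewrite ge0_sume_distrr//; apply: eq_bigr => x _.
  rewrite -ge0_muleDl ?lee_fin ?sign_weight_ge0//=; congr (_ * _)%E.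
  rewrite -EFinD; congr (_%:E); rewrite /sign_weight /= addbF addbT.
  by case: (s _); rewrite /= ?expr0 ?expr1; lra.
exists (~` [set z : 'M[R]_(m1, m2) * R | `|z.2| <= eta]); split=> //.
  apply: measurableC; rewrite -[X in measurable X]setTI.
  by apply: measurable_fun_le => //; exact: measurableT_comp.
rewrite /= discrete_lawE big1// => i _; rewrite diracE memNset ?mule0//=.
apply; rewrite normrM normr_sign mulr1 ger0_norm//.
Qed.

(** Bias and variance: given the entry, the label has variance [eta ^+ 2 * (1 - eps ^+ 2)], which
    cancels in the excess risk. *)
Lemma risk_sign_law s A :
  risk (sign_law s) A = (N^-1 * \sum_(x : 'I_m1 * 'I_m2)
    (A x.1 x.2 - sign_matrix s x.1 x.2) ^+ 2 + eta ^+ 2 * (1 - eps ^+ 2))%:E.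
Proof.
rewrite /risk unlock discrete_law_integral => [|z|]; last 2 first.
- by rewrite lee_fin sqr_ge0.
- apply/measurable_EFinP; apply: measurable_funX; apply: measurable_funB => //.
  apply: measurableT_comp => //; exact: measurable_inner_prod.
rewrite sumEFin; congr (_%:E); rewrite sum_prod_bool /=.
transitivity (\sum_(x : 'I_m1 * 'I_m2)
  (N^-1 * (A x.1 x.2 - sign_matrix s x.1 x.2) ^+ 2 +
   N^-1 * (eta ^+ 2 * (1 - eps ^+ 2)))); last first.
  rewrite big_split /= -mulr_sumr sum_cst.
  by rewrite mulVKf// gt_eqF.
apply: eq_bigr => -[j k] _; rewrite !inner_prod_basis /sign_weight /= mxE.
rewrite addbF addbT; move: N^-1 => u.
by case: (s _); rewrite /= ?expr0 ?expr1; field.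
Qed.

(** Outside cell [k] the two laws agree. Inside it the label probabilities are swapped, so each
    entry contributes [N^-1 * Num.sqrt (1 - eps ^+ 2)], which is at least
    [N^-1 * (1 - eps ^+ 2)]. *)
Lemma sign_weight_affinity k s :
  1 - eps ^+ 2 * #|[pred x | cell x == k]|%:R / N <=
  \sum_i Num.sqrt (sign_weight s i * sign_weight (flip k s) i).
Proof.
have e21 : 0 <= 1 - eps ^+ 2 by rewrite subr_ge0 expr_le1//; case/andP: eps01.
have iN0 : 0 <= N^-1 by rewrite invr_ge0 ler0n.
have -> : 1 - eps ^+ 2 * #|[pred x | cell x == k]|%:R / N =
    \sum_(x : 'I_m1 * 'I_m2) (N^-1 - eps ^+ 2 / N * (cell x == k)%:R).
  rewrite sumrB -mulr_sumr sum_cst mulfV ?gt_eqF//.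
  by rewrite -natr_sum -big_mkcond /= sum1_card mulrAC.
rewrite sum_prod_bool; apply: ler_sum => x _.
have flipE b : sign_weight (flip k s) (x, b) =
    if cell x == k then sign_weight s (x, ~~ b) else sign_weight s (x, b).
  rewrite /sign_weight ffunE /=.
  by case: eqP => _; rewrite ?addbF // addbT addNb addbN.
rewrite !flipE; case: eqP => _ /=.
  have prodE : sign_weight s (x, true) * sign_weight s (x, false) =
      (N^-1 / 2) ^+ 2 * (1 - eps ^+ 2).
    rewrite /sign_weight /= addbF addbT.
    by move: N^-1 => u; case: (s _); rewrite /= ?expr0 ?expr1; field.
  rewrite [X in _ + Num.sqrt X]mulrC prodE sqrtrM ?sqr_ge0//.
  rewrite sqrtr_sqr ger0_norm; last by rewrite divr_ge0.
  have : 1 - eps ^+ 2 <= Num.sqrt (1 - eps ^+ 2).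
    rewrite -[leLHS]ger0_norm// -sqrtr_sqr ler_wsqrtr// expr2 ler_piMr//.
    by rewrite gerBl sqr_ge0.
  move: iN0; nra.
rewrite !mulr0 subr0 -!expr2 !sqrtr_sqr !ger0_norm ?sign_weight_ge0//.
rewrite /sign_weight /= addbF addbT.
by case: (s _); rewrite /= ?expr0 ?expr1; lra.
Qed.

End sign_model.

(** * From sign errors to excess risk *)

(** [L] stands for [maxn m1 m2 * r]; the condition on the fibers bounds the mass of each cell by
    [2 / L]. *)
Lemma sign_law_lower_bound (R : realType) (m1 m2 n L : nat) (K : finType)
    (cell : 'I_m1 * 'I_m2 -> K) (eta : R)
    (Ahat : {mfun n.-tuple ('M[R]_(m1, m2) * R)%type >-> 'M[R]_(m1, m2)}) :
  (0 < m1 * m2)%N -> 0 < eta -> (0 < L <= n)%N ->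
  (forall k, #|[pred x | cell x == k]| * L <= 2 * (m1 * m2))%N ->
  exists (eps : R) (s : {ffun K -> bool})
    (P : probability ('M[R]_(m1, m2) * R)%type R),
    bounded_laws eta P /\
    ((16^-1)%:E <= iid_law P n
      [set t | risk P (sign_matrix cell eps eta s) +
                 (128^-1 * eta ^+ 2 * L%:R / n%:R)%:E <= risk P (Ahat t)])%E.
Proof.
move=> m0 eta0 /andP[L0 Ln] fiber.
have n0 : 0 < n%:R :> R by rewrite ltr0n (leq_trans L0).
have L0' : 0 < L%:R :> R by rewrite ltr0n.
have Ln' : L%:R <= n%:R :> R by rewrite ler_nat.
have N0 : 0 < (m1 * m2)%:R :> R by rewrite ltr0n.
(* With the factor 8, flipping a cell costs at most [2 * eps ^+ 2 / L = 1 / (4 * n)] of affinity, so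
   [n] draws cost at most [1 / 4]. *)
pose eps : R := Num.sqrt (L%:R / (8 * n%:R)).
have eps0 : 0 <= eps by exact: sqrtr_ge0.
have eps2 : eps ^+ 2 = L%:R / (8 * n%:R).
  by rewrite sqr_sqrtr// divr_ge0// mulr_ge0// ltW.
have eps01 : 0 <= eps <= 1.
  rewrite eps0 -(@expr_le1 _ 2)// eps2 ler_pdivrMr ?mulr_gt0//; lra.
have cardX : #|{: 'I_m1 * 'I_m2}| = (m1 * m2)%N by rewrite card_prod !card_ord.
(* [true] codes a negative sign; a zero estimate is read as positive. *)
pose guess (x : 'I_m1 * 'I_m2) (t : n.-tuple ('I_m1 * 'I_m2 * bool)) : bool :=
  Ahat (map_tuple (sign_point eta) t) x.1 x.2 < 0.
(* [h = 2 * eps ^+ 2 / L], the largest affinity loss caused by flipping one cell. *)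
pose h : R := (4 * n%:R)^-1.
have [||||||s] := @assouad R _ _ K n cell (sign_weight cell eps) h guess.
- by rewrite cardX.
- by move=> s i; exact: sign_weight_ge0.
- by move=> s; exact: sign_weight_sum1.
- rewrite invr_ge0 mulr_ge0 ?(ltW n0)//= invf_le1 ?mulr_gt0//.
  have : 1 <= n%:R :> R by rewrite ler1n (leq_trans L0).
  lra.
- by rewrite /h invfM mulrCA mulfV ?gt_eqF// mulr1 mul1r.
- move=> k s; apply: le_trans (sign_weight_affinity m0 cell eps01 k s).
  rewrite lerD2l lerN2 ler_pdivrMr// eps2 /h.
  have := fiber k; rewrite -(ler_nat R) !natrM => fk.
  have -> : L%:R / (8 * n%:R) * #|[pred x | cell x == k]|%:R =
    (#|[pred x | cell x == k]|%:R * L%:R) / (8 * n%:R) :> R by rewrite [LHS]mulrC mulrA.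
  rewrite ler_pdivrMr ?mulr_gt0//; apply: le_trans fk _.
  rewrite le_eqVlt; apply/orP; left; apply/eqP; field.
  by rewrite gt_eqF.
rewrite cardX => bound.
exists eps, s, (sign_law m0 cell eta eps01 s); split.
  exact/sign_law_bounded/ltW.
set B := [set t | _].
have BE : B = [set t | 128^-1 * eta ^+ 2 * L%:R / n%:R <= (m1 * m2)%:R^-1 *
    \sum_(x : 'I_m1 * 'I_m2) (Ahat t x.1 x.2 -
      sign_matrix cell eps eta s x.1 x.2) ^+ 2].
  apply/funext => t; rewrite /B /= !risk_sign_law -EFinD lee_fin.
  rewrite [X in _ * X + _ + _]big1 ?mulr0 ?add0r => [|x _]; last first.
    by rewrite subrr expr0n.
  by rewrite addrC lerD2r.
(* The measurability of [Ahat] makes the event one that [iid_law_discrete] can evaluate. *)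
have mB : measurable B.
  rewrite BE -[X in measurable X]setTI; apply: measurable_fun_le => //.
  apply: measurable_funM => //; apply: measurable_sum => x.
  apply: measurable_funX; apply: measurable_funB => //.
  apply: (measurableT_comp (measurable_mx_entry x.1 x.2)).
  exact: measurable_funPT.
rewrite iid_law_discrete//.
under eq_bigr do rewrite -EFinM.
rewrite sumEFin lee_fin -div1r; apply: le_trans bound _.
apply: ler_sum => t _; rewrite indicE.
have [err|_] /= := leP ((m1 * m2)%:R / 16 : R) (\sum_x (guess x t != s (cell x))%:R);
  last first.
  rewrite mulr0n mulr_ge0 ?ler0n// prodr_ge0// => i _; exact: sign_weight_ge0.
rewrite mem_set ?mulr1// BE /=.
rewrite -(ler_pM2l N0) mulVKf ?gt_eqF//.
(* An estimate of the wrong sign is at least [eps * eta] away from the entry of the sign matrix. *)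
have sq x : (eps * eta) ^+ 2 * (guess x t != s (cell x))%:R <=
    (Ahat (map_tuple (sign_point eta) t) x.1 x.2 -
      sign_matrix cell eps eta s x.1 x.2) ^+ 2.
  rewrite mxE -surjective_pairing /guess.
  have : 0 <= eps * eta by rewrite mulr_ge0// ltW.
  move: (eps * eta) (Ahat _ _ _) => a b a0.
  case: ltP => b0; case: (s _); rewrite /= ?expr0 ?expr1 ?mulr0 ?mulr1 ?sqr_ge0//; nra.
apply: le_trans (ler_sum _ (fun x _ => sq x)).
(* [128 = 8 * 16], with 8 from [eps ^+ 2] and 16 from the fraction of wrong signs. *)
rewrite -mulr_sumr exprMn eps2.
apply: le_trans (ler_wpM2l _ err); last first.
  by rewrite mulr_ge0 ?divr_ge0 ?mulr_ge0 ?sqr_ge0// ltW.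
rewrite le_eqVlt; apply/orP; left; apply/eqP; field.
by rewrite gt_eqF.
Qed.

(** * Cells and low rank *)

(** The quotient [k %/ r] is injective on a residue class, which thus has at most [m %/ r + 1]
    elements; [r <= m] turns the extra one into the factor 2. *)
Lemma card_modn_fiber (m r : nat) (l : nat) : (0 < r <= m)%N ->
  (#|[pred k : 'I_m | k %% r == l]%N| * r <= 2 * m)%N.
Proof.
move=> /andP[r0 rm].
suff le : (#|[pred k : 'I_m | k %% r == l]%N| <= (m %/ r).+1)%N.
  apply: leq_trans (leq_mul le (leqnn r)) _.
  have := leq_divM m r; nia.
pose q (k : 'I_m) : 'I_(m %/ r).+1 := inord (k %/ r).
have qE k : q k = (k %/ r)%N :> nat by rewrite inordK// ltnS leq_div2r// ltnW.
rewrite -[leqRHS]card_ord -(@card_in_imset _ _ q).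
  exact: max_card.
move=> k k'; rewrite !inE => /eqP kl /eqP k'l /(congr1 val); rewrite /= !qE => qq.
by apply: val_inj; rewrite /= (divn_eq k r) (divn_eq k' r) kl k'l qq.
Qed.

(* The sign of each entry is shared along the shorter dimension modulo [r],
   so that a hidden sign is observed about [n / (maxn m1 m2 * r)] times. *)
Lemma sign_cells (R : realType) (m1 m2 r : nat) : (0 < r <= minn m1 m2)%N ->
  exists (K : finType) (cell : 'I_m1 * 'I_m2 -> K),
    (forall k, #|[pred x | cell x == k]| * (maxn m1 m2 * r) <=
       2 * (m1 * m2))%N /\
    forall (eps eta : R) (s : {ffun K -> bool}),
      (\rank (sign_matrix cell eps eta s) <= r)%N.
Proof.
case: r => // r; rewrite leq_min => /and3P[_ r1 r2].
pose md k : 'I_r.+1 := Ordinal (ltn_pmod k (ltn0Sn r)).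
have fib m l : (r < m)%N -> (#|[pred k : 'I_m | md k == l]| * r.+1 <= 2 * m)%N.
  by move=> rm; apply: card_modn_fiber.
have [le|/ltnW le] := leqP m2 m1.
(* Here the maximum is [m1]: a cell is one row restricted to a residue class of columns. *)
- exists ('I_m1 * 'I_r.+1)%type, (fun x : 'I_m1 * 'I_m2 => (x.1, md x.2)).
  split=> [[i l]|eps eta s].
    rewrite (_ : #|_| = #|[pred k : 'I_m2 | md k == l]|).
      have := fib m2 l r2; nia.
    rewrite -[RHS]mul1n -(card1 i) -cardX; apply: eq_card => -[j k].
    by rewrite !inE.
  (* Columns with the same residue coincide, so the matrix factors through [r.+1] columns. *)
  have -> : sign_matrix (fun x : 'I_m1 * 'I_m2 => (x.1, md x.2)) eps eta s =
      (\matrix_(i < m1, l < r.+1) (eps * eta * (-1) ^+ s (i, l))) *m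
      (\matrix_(l < r.+1, k < m2) (md k == l)%:R).
    apply/matrixP => i k; rewrite !mxE (bigD1 (md k))//= big1 => [|l lk].
      by rewrite !mxE eqxx mulr1 addr0.
    by rewrite !mxE eq_sym (negPf lk) mulr0.
  exact: mulmx_max_rank.
(* The same with rows and columns exchanged. *)
exists ('I_r.+1 * 'I_m2)%type, (fun x : 'I_m1 * 'I_m2 => (md x.1, x.2)).
split=> [[l k]|eps eta s].
  rewrite (_ : #|_| = #|[pred i : 'I_m1 | md i == l]|).
    have := fib m1 l r1; nia.
  rewrite -[RHS]muln1 -(card1 k) -cardX; apply: eq_card => -[j k'].
  by rewrite !inE.
have -> : sign_matrix (fun x : 'I_m1 * 'I_m2 => (md x.1, x.2)) eps eta s =
    (\matrix_(i < m1, l < r.+1) (md i == l)%:R) *m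
    (\matrix_(l < r.+1, k < m2) (eps * eta * (-1) ^+ s (l, k))).
  apply/matrixP => i k; rewrite !mxE (bigD1 (md i))//= big1 => [|l li].
    by rewrite !mxE eqxx mul1r addr0.
  by rewrite !mxE eq_sym (negPf li) mul0r.
exact: mulmx_max_rank.
Qed.

Theorem theorem10 (R : realType) :
  exists beta c : R, [/\ 0 < beta < 1, 0 < c &
    forall (m1 m2 n r : nat) (eta : R),
      0 < eta ->
      (1 <= r <= minn m1 m2)%N ->
      (maxn m1 m2 * r <= n)%N ->
      (beta%:E <=
        ereal_inf [set
          ereal_sup [set
            ereal_sup [set
              iid_law P n
                [set s : n.-tuple ('M[R]_(m1, m2) * R)%type |
                  risk P A + (c * eta ^+ 2 * (maxn m1 m2 * r)%:R / n%:R)%:E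
                    <= risk P (Ahat s)]
            | P in bounded_laws eta]
          | A in [set A : 'M[R]_(m1, m2) | (\rank A <= r)%N]]
        | Ahat in [set: {mfun n.-tuple ('M[R]_(m1, m2) * R)%type
                          >-> 'M[R]_(m1, m2)}]])%E].
Proof.
exists 16^-1, 128^-1; split; [lra|lra|move=> m1 m2 n r eta eta0 rm Ln].
have [r0 r1 r2] : [/\ 0 < r, r <= m1 & r <= m2]%N.
  by move: rm; rewrite leq_min => /and3P.
have m1_gt0 := leq_trans r0 r1; have m2_gt0 := leq_trans r0 r2.
have [K [cell [fiber rank_le]]] := @sign_cells R _ _ _ rm.
apply: le_ereal_inf_tmp => _ [Ahat _ <-].
(* The pattern and the law may depend on the estimator, since the suprema lie inside the infimum. *)
have [||||eps [s [P [bP le]]]] :=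
  @sign_law_lower_bound R m1 m2 n (maxn m1 m2 * r) K cell eta Ahat.
- by rewrite muln_gt0 m1_gt0.
- by [].
- by rewrite muln_gt0 r0 leq_max m1_gt0.
- exact: fiber.
set A := sign_matrix cell eps eta s in le.
apply: le_trans (le_trans le _) (ereal_sup_ubound _); last first.
  by exists A => //; exact: rank_le.
by apply: ereal_sup_ubound; exists P.
Qed.
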